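(* Let $\mathcal U$ be a universal Martin-Löf test. Then $\mathsf{LAY}_{\mathcal U}\ast\mathsf{LAY}_{\mathcal U}\le_{\mathrm W}\mathsf{LAY}_{\mathcal U}$; that is, whenever $f_0\colon\subseteq R\rightrightarrows S$ and $g_0\colon\subseteq Q\rightrightarrows R$ are multi-valued partial functions on represented spaces with $f_0\le_{\mathrm W}\mathsf{LAY}_{\mathcal U}$, $g_0\le_{\mathrm W}\mathsf{LAY}_{\mathcal U}$, and $g_0(x)\subseteq\mathrm{dom}(f_0)$ for all $x\in\mathrm{dom}(g_0)$, we have $f_0\circ g_0\le_{\mathrm W}\mathsf{LAY}_{\mathcal U}$.
   Context: Cantor space $2^\omega$, Lebesgue measure $\lambda$. A Martin-Löf (ML) test is a sequence $(\mathcal V_i)_{i\in\omega}$ of open subsets of $2^\omega$ such that $\{\langle i,\sigma\rangle:[\sigma]\subseteq\mathcal V_i\}$ is c.e. and $\lambda(\mathcal V_i)\le 2^{-i}$; it is universal if $\bigcap_i\mathcal V'_i\subseteq\bigcap_i\mathcal V_i$ for every ML-test $\mathcal V'$. $\mathrm{MLR}$ is the set of Martin-Löf random sequences. A representation of a set $X$ is a surjective partial map $\delta_X:\subseteq\omega^\omega\to X$. A realizer of a multi-valued partial function $f:\subseteq X\rightrightarrows Y$ is a partial $\Gamma:\subseteq\omega^\omega\to\omega^\omega$ with $\delta_Y(\Gamma(p))\in f(\delta_X(p))$ for all $p\in\mathrm{dom}(f\circ\delta_X)$. $f\le_{\mathrm W} g$ if there are Turing functionals $\Phi,\Psi$ such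 that $p\mapsto\Psi(\langle p,\Gamma(\Phi(p))\rangle)$ realizes $f$ for every realizer $\Gamma$ of $g$. $\mathrm{MLR}$ is represented by the identity on $\mathrm{MLR}\subseteq\omega^\omega$, $\omega$ by $\chi_{\{n\}}\mapsto n$. $\mathsf{LAY}_{\mathcal U}\colon\mathrm{MLR}\rightrightarrows\omega$, $\mathsf{LAY}_{\mathcal U}(X)=\{i:X\notin\mathcal U_i\}$. Composition of multi-valued functions: $(f_0\circ g_0)(x)=\bigcup_{y\in g_0(x)}f_0(y)$. The compositional product $f\ast g$ is the $\le_{\mathrm W}$-maximum (which exists) of $\{f_0\circ g_0 : f_0\le_{\mathrm W} f,\ g_0\le_{\mathrm W} g,\ f_0,g_0 \text{ composable}\}$. *)

(* Defs.v *)
From Stdlib Require Import Arith List.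
Import ListNotations.

(** Cantor pairing on nat (a bijection nat*nat -> nat). *)
Definition npair (x y : nat) : nat := (x + y) * (x + y + 1) / 2 + y.

Fixpoint code_str (s : list bool) : nat :=
  match s with
  | [] => 0
  | b :: s' => 2 * code_str s' + 1 + (if b then 1 else 0)
  end.

Definition pairB (p q : nat -> nat) : nat -> nat :=
  fun n => if Nat.even n then p (Nat.div2 n) else q (Nat.div2 n).

Inductive prcode : Type :=
| cZero
| cSucc
| cId
| cFst
| cSnd
| cOracle
| cPair (f g : prcode)
| cComp (f g : prcode)
| cRec (f g : prcode)
| cMu (f : prcode).

Inductive eval (a : nat -> nat) : prcode -> nat -> nat -> Prop :=
| e_zero x : eval a cZero x 0
| e_succ x : eval a cSucc x (S x)
| e_id x : eval a cId x x
| e_fst x y : eval a cFst (npair x y) x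
| e_snd x y : eval a cSnd (npair x y) y
| e_oracle x : eval a cOracle x (a x)
| e_pair f g x y z :
    eval a f x y -> eval a g x z -> eval a (cPair f g) x (npair y z)
| e_comp f g x y z :
    eval a g x y -> eval a f y z -> eval a (cComp f g) x z
| e_rec0 f g x y :
    eval a f x y -> eval a (cRec f g) (npair x 0) y
| e_recS f g x n z y :
    eval a (cRec f g) (npair x n) z ->
    eval a g (npair x (npair n z)) y ->
    eval a (cRec f g) (npair x (S n)) y
| e_mu f x n :
    eval a f (npair x n) 0 ->
    (forall m, m < n -> exists k, eval a f (npair x m) (S k)) ->
    eval a (cMu f) x n.

Definition TF (e : prcode) (p q : nat -> nat) : Prop :=
  forall n, eval p e n (q n).

Definition ce (A : nat -> Prop) : Prop :=
  exists e : prcode, forall n, A n <-> exists y, eval (fun _ => 0) e n y.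

Definition cantor := nat -> bool.

Definition has_prefix (s : list bool) (X : cantor) : Prop :=
  forall k, k < length s -> nth k s false = X k.

Definition prefix (X : cantor) (n : nat) : list bool := map X (seq 0 n).

Definition cyl_sub (s : list bool) (A : cantor -> Prop) : Prop :=
  forall Y, has_prefix s Y -> A Y.

Definition is_open (A : cantor -> Prop) : Prop :=
  forall X, A X -> exists n, cyl_sub (prefix X n) A.

(** [measure_le A i] : lambda(A) <= 2^-i, for A open.  Since
    lambda(A) = sup_n #{tau in 2^n : [tau] subset A} / 2^n for open A,
    this says that for every n, every list of distinct strings of length n
    whose cylinders lie in A has at most 2^(n-i) elements. *)
Definition measure_le (A : cantor -> Prop) (i : nat) : Prop :=
  forall (n : nat) (L : list (list bool)),
    NoDup L ->
    (forall t, In t L -> length t = n /\ cyl_sub t A) ->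
    length L * 2 ^ i <= 2 ^ n.

Definition ML_test (V : nat -> cantor -> Prop) : Prop :=
  (forall i, is_open (V i)) /\
  ce (fun m => exists i s, m = npair i (code_str s) /\ cyl_sub s (V i)) /\
  (forall i, measure_le (V i) i).

Definition universal_ML_test (U : nat -> cantor -> Prop) : Prop :=
  ML_test U /\
  forall V, ML_test V -> forall X, (forall i, V i X) -> forall i, U i X.

Definition MLR (X : cantor) : Prop :=
  forall V, ML_test V -> ~ (forall i, V i X).

Definition is_representation {X : Type} (d : (nat -> nat) -> X -> Prop) : Prop :=
  (forall p x y, d p x -> d p y -> x = y) /\ (forall x, exists p, d p x).

(** A multi-valued partial function f :⊆ X ⇉ Y is a relation;
    dom f = {x | f(x) nonempty}. *)
Definition dom {X Y : Type} (f : X -> Y -> Prop) (x : X) : Prop := exists y, f x y.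

Definition mcomp {X Y Z : Type} (f : Y -> Z -> Prop) (g : X -> Y -> Prop) :
  X -> Z -> Prop := fun x z => exists y, g x y /\ f y z.

Definition realizes {X Y : Type} (dX : (nat -> nat) -> X -> Prop)
  (dY : (nat -> nat) -> Y -> Prop) (f : X -> Y -> Prop)
  (G : (nat -> nat) -> (nat -> nat) -> Prop) : Prop :=
  forall p x, dX p x -> dom f x ->
    exists q, G p q /\ exists y, dY q y /\ f x y.

Definition Wred {X Y Z W : Type}
  (dX : (nat -> nat) -> X -> Prop) (dY : (nat -> nat) -> Y -> Prop)
  (f : X -> Y -> Prop)
  (dZ : (nat -> nat) -> Z -> Prop) (dW : (nat -> nat) -> W -> Prop)
  (g : Z -> W -> Prop) : Prop :=
  exists Phi Psi : prcode,
    forall Gamma : (nat -> nat) -> option (nat -> nat),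
      realizes dZ dW g (fun p q => Gamma p = Some q) ->
      realizes dX dY f
        (fun p s => exists q r, TF Phi p q /\ Gamma q = Some r /\
                                TF Psi (pairB p r) s).

Definition MLRt : Type := {X : cantor | MLR X}.

Definition delta_MLR (p : nat -> nat) (X : MLRt) : Prop :=
  forall n, p n = (if proj1_sig X n then 1 else 0).

Definition delta_nat (p : nat -> nat) (n : nat) : Prop :=
  forall k, p k = (if Nat.eqb k n then 1 else 0).

Definition LAY (U : nat -> cantor -> Prop) (X : MLRt) (i : nat) : Prop :=
  ~ U i (proj1_sig X).

(* Main.v *)
(** If [p] names an instance of [g0], the reduction of [g0] computes a random [X] from [p], every [i] with [X] outside [U i] yields an instance of [f0], and the reduction of [f0] computes from it a random [Y]. A pair [(i, j)] is a correct guess if [X] is outside [U i] and the resulting [Y] is outside [U j]; incorrect guesses are recognised by an enumeration relative to [p].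

Run through the guesses while copying the bits of [X] to the output [Z]. When the current guess is refuted at stage [t], append zeros to the output until its cylinder lies in [U 0], ..., [U t] (this happens, since a universal test captures every sequence ending in zeros), then restart the copy of [X] with the next guess. As only finitely many guesses are refuted, [Z] is a finite string followed by [X], hence random. If [Z] is outside [U k], no guess is refuted at a stage [t >= k], so the guess at stage [k] is correct and can be found from [p] and [k]. *)
From Stdlib Require Import Arith List Lia FinFun Cantor Classical ClassicalEpsilon FunctionalExtensionality.
Require Import Defs.
Import ListNotations.

(** * Evaluation and oracle substitution *)

Arguments npair : simpl never.

(** The division-free specification of the standard Cantor pairing identifies it with [npair] and so
    supplies the inverse projections. *)
Lemma npair_to_nat x y : npair x y = Cantor.to_nat (x, y).
Proof.
  unfold npair. pose proof (Cantor.to_nat_spec x y) as H.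
  replace ((x + y) * (x + y + 1)) with ((Cantor.to_nat (x, y) - y) * 2) by nia.
  rewrite Nat.div_mul by lia. nia.
Qed.

Definition pi1 (n : nat) : nat := fst (Cantor.of_nat n).
Definition pi2 (n : nat) : nat := snd (Cantor.of_nat n).

Lemma pi1_npair x y : pi1 (npair x y) = x.
Proof. unfold pi1. now rewrite npair_to_nat, Cantor.cancel_of_to. Qed.

Lemma pi2_npair x y : pi2 (npair x y) = y.
Proof. unfold pi2. now rewrite npair_to_nat, Cantor.cancel_of_to. Qed.

Lemma npair_pi n : npair (pi1 n) (pi2 n) = n.
Proof.
  unfold pi1, pi2. rewrite npair_to_nat, <- surjective_pairing.
  apply Cantor.cancel_to_of.
Qed.

Lemma npair_inj x y x' y' : npair x y = npair x' y' -> x = x' /\ y = y'.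
Proof.
  intros H. split.
  - now rewrite <- (pi1_npair x y), H, pi1_npair.
  - now rewrite <- (pi2_npair x y), H, pi2_npair.
Qed.

(** Ensures that stage [npair k v], which examines evidence [v], comes no earlier than stage [k]. *)
Lemma npair_ge_l x y : x <= npair x y.
Proof. rewrite npair_to_nat. pose proof (Cantor.to_nat_non_decreasing x y). lia. Qed.

Ltac npair_simpl := repeat (rewrite pi1_npair in * || rewrite pi2_npair in *).

Lemma eval_fst a x : eval a cFst x (pi1 x).
Proof. rewrite <- (npair_pi x) at 1. constructor. Qed.

Lemma eval_snd a x : eval a cSnd x (pi2 x).
Proof. rewrite <- (npair_pi x) at 1. constructor. Qed.

Lemma eval_pair_iff a f g x v :
  eval a (cPair f g) x v <->
  exists y z, v = npair y z /\ eval a f x y /\ eval a g x z.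
Proof.
  split.
  - intros H. inversion H; subst; eauto.
  - intros (y & z & -> & Hy & Hz). now constructor.
Qed.

Lemma eval_comp_iff a f g x z :
  eval a (cComp f g) x z <-> exists y, eval a g x y /\ eval a f y z.
Proof.
  split.
  - intros H. inversion H; subst; eauto.
  - intros (y & Hy & Hz). econstructor; eauto.
Qed.

Lemma eval_rec0_iff a f g x y :
  eval a (cRec f g) (npair x 0) y <-> eval a f x y.
Proof.
  split; [intros H | now constructor].
  inversion H; subst;
    match goal with E : npair _ _ = npair _ _ |- _ => apply npair_inj in E as [? ?] end;
    subst; [assumption | discriminate].
Qed.

Lemma eval_recS_iff a f g x n y :
  eval a (cRec f g) (npair x (S n)) y <->
  exists z, eval a (cRec f g) (npair x n) z /\ eval a g (npair x (npair n z)) y.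
Proof.
  split; [intros H | intros (z & Hz & Hy); econstructor; eauto].
  inversion H; subst;
    match goal with
    | E : npair _ _ = npair _ _ |- _ => apply npair_inj in E as [? E']
    end; [discriminate | injection E' as ->; subst; eauto].
Qed.

Lemma eval_mu_iff a f x n :
  eval a (cMu f) x n <->
  eval a f (npair x n) 0 /\
  forall m, m < n -> exists k, eval a f (npair x m) (S k).
Proof.
  split.
  - intros H. inversion H; subst; auto.
  - intros [H1 H2]. now constructor.
Qed.

Ltac eval_base H :=
  inversion H; subst;
  repeat match goal with
  | E : npair _ _ = npair _ _ |- _ => apply npair_inj in E as [? ?]; subst
  end.

Lemma eval_det a e x y y' : eval a e x y -> eval a e x y' -> y = y'.
Proof.
  revert x y y'.
  induction e as [| | | | | |f IHf g IHg|f IHf g IHg|f IHf g IHg|f IHf];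
    intros x y y' H H';
    try (eval_base H; eval_base H'; reflexivity).
  - rewrite eval_pair_iff in H, H'.
    destruct H as (u & v & -> & Hu & Hv), H' as (u' & v' & -> & Hu' & Hv').
    f_equal; eauto.
  - rewrite eval_comp_iff in H, H'.
    destruct H as (u & Hu & Hv), H' as (u' & Hu' & Hv').
    rewrite <- (IHg _ _ _ Hu Hu') in Hv'. eauto.
  - rewrite <- (npair_pi x) in H, H'. revert y y' H H'.
    generalize (pi1 x) as u. intros u. induction (pi2 x) as [|n IHn]; intros y y' H H'.
    + rewrite eval_rec0_iff in H, H'. eauto.
    + rewrite eval_recS_iff in H, H'.
      destruct H as (z & Hz & Hy), H' as (z' & Hz' & Hy').
      rewrite <- (IHn _ _ Hz Hz') in Hy'. eauto.
  - rewrite eval_mu_iff in H, H'. destruct H as [H1 H2], H' as [H1' H2'].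
    (* The smaller of two distinct results would be a zero of [f] and, as a position below the
       larger one, also carry a positive value. *)
    destruct (Nat.lt_trichotomy y y') as [L|[L|L]]; [|assumption|].
    + destruct (H2' _ L) as [k Hk]. discriminate (IHf _ _ _ H1 Hk).
    + destruct (H2 _ L) as [k Hk]. discriminate (IHf _ _ _ H1' Hk).
Qed.

Lemma eval_comp_val a f g x y z :
  eval a g x y -> (eval a (cComp f g) x z <-> eval a f y z).
Proof.
  intros Hy. rewrite eval_comp_iff. split; [|eauto].
  intros (y' & Hy' & Hz). now rewrite (eval_det _ _ _ _ _ Hy Hy').
Qed.

(** The translated program receives a pair [npair i x] of a parameter [i] and the original input [x]; a query [z] to the oracle becomes a run of [d] on [npair i z]. *)
Fixpoint subst_oracle (d e : prcode) : prcode :=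
  match e with
  | cZero => cZero
  | cSucc => cComp cSucc cSnd
  | cId => cSnd
  | cFst => cComp cFst cSnd
  | cSnd => cComp cSnd cSnd
  | cOracle => d
  | cPair f g => cPair (subst_oracle d f) (subst_oracle d g)
  | cComp f g => cComp (subst_oracle d f) (cPair cFst (subst_oracle d g))
  | cRec f g =>
      cComp
        (cRec (subst_oracle d f)
           (cComp (subst_oracle d g)
              (cPair (cComp cFst cFst) (cPair (cComp cSnd cFst) cSnd))))
        (cPair (cPair cFst (cComp cFst cSnd)) (cComp cSnd cSnd))
  | cMu f =>
      cMu (cComp (subst_oracle d f)
             (cPair (cComp cFst cFst) (cPair (cComp cSnd cFst) cSnd)))
  end.

Ltac eval_wiring := repeat econstructor.

(** [cRec] and [cMu] pair their counter on the outside; this moves the parameter back to the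
    outermost left place, where translated bodies expect it. *)
Lemma eval_assoc a i x m :
  eval a (cPair (cComp cFst cFst) (cPair (cComp cSnd cFst) cSnd))
    (npair (npair i x) m) (npair i (npair x m)).
Proof. eval_wiring. Qed.

(** Being an equivalence, it transfers divergence too, as semi-decision procedures require. The
    program [d] must be correct only at the one parameter [i]. *)
Lemma eval_subst_oracle a d i O :
  (forall x, eval a d (npair i x) (O x)) ->
  forall e x y, eval a (subst_oracle d e) (npair i x) y <-> eval O e x y.
Proof.
  intros Hd e.
  induction e as [| | | | | |f IHf g IHg|f IHf g IHg|f IHf g IHg|f IHf];
    intros x y; cbn [subst_oracle].
  - split; intros H; eval_base H; constructor.
  - rewrite eval_comp_val by constructor. split; intros H; eval_base H; constructor.
  - split; intros H; eval_base H; constructor.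
  - rewrite eval_comp_val by constructor. split; intros H; eval_base H; constructor.
  - rewrite eval_comp_val by constructor. split; intros H; eval_base H; constructor.
  - split; intros H.
    + rewrite (eval_det _ _ _ _ _ H (Hd x)). constructor.
    + eval_base H. apply Hd.
  - rewrite !eval_pair_iff. now setoid_rewrite IHf; setoid_rewrite IHg.
  - rewrite !eval_comp_iff. split.
    + intros (v & Hv & Hy). apply eval_pair_iff in Hv as (i' & u & -> & Hi & Hu).
      eval_base Hi. exists u. now rewrite <- IHg, <- IHf.
    + intros (u & Hu & Hy). exists (npair i u). rewrite IHf. split; [|assumption].
      constructor; [constructor|]. now rewrite IHg.
  - rewrite <- (npair_pi x). generalize (pi1 x) as u, (pi2 x) as n. intros u n.
    rewrite (eval_comp_val _ _ _ _ (npair (npair i u) n)) by eval_wiring.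
    revert y. induction n as [|n IHn]; intros y.
    + rewrite !eval_rec0_iff. apply IHf.
    + rewrite !eval_recS_iff. setoid_rewrite IHn.
      setoid_rewrite (eval_comp_val _ _ _ _ _ _ (eval_assoc _ _ _ _)).
      now setoid_rewrite IHg.
  - rewrite !eval_mu_iff.
    setoid_rewrite (eval_comp_val _ _ _ _ _ _ (eval_assoc _ _ _ _)).
    now setoid_rewrite IHf.
Qed.

(** Step-bounded evaluation: [0] stands for no result, [S y] for the result [y]; [t] bounds only the searches of [cMu]. *)
Fixpoint fuel (a : nat -> nat) (e : prcode) (t x : nat) : nat :=
  match e with
  | cZero => 1
  | cSucc => S (S x)
  | cId => S x
  | cFst => S (pi1 x)
  | cSnd => S (pi2 x)
  | cOracle => S (a x)
  | cPair f g =>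
      match fuel a f t x with
      | 0 => 0
      | S y => match fuel a g t x with 0 => 0 | S z => S (npair y z) end
      end
  | cComp f g =>
      match fuel a g t x with 0 => 0 | S y => fuel a f t y end
  | cRec f g =>
      nat_rect (fun _ => nat) (fuel a f t (pi1 x))
        (fun n z => match z with
                    | 0 => 0
                    | S z' => fuel a g t (npair (pi1 x) (npair n z'))
                    end)
        (pi2 x)
  | cMu f =>
      Nat.pred
        (nat_rect (fun _ => nat) 0
           (fun m s => match s with
                       | 0 => match fuel a f t (npair x m) with
                              | 0 => 1
                              | S v => match v with 0 => S (S m) | S _ => 0 end
                              end
                       | S s' => S s'
                       end)
           t)
  end.

(** [0]: all values so far are results greater than zero; [1]: stuck at a missing result; [S (S n)]: found the first zero at [n]. Values are encoded as for [fuel]. *)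
Definition search (h : nat -> nat) (N : nat) : nat :=
  nat_rect (fun _ => nat) 0
    (fun m s => match s with
                | 0 => match h m with
                       | 0 => 1
                       | S v => match v with 0 => S (S m) | S _ => 0 end
                       end
                | S s' => S s'
                end)
    N.

Lemma search_zero h N :
  search h N = 0 <-> forall m, m < N -> exists k, h m = S (S k).
Proof.
  induction N as [|N IH]; cbn.
  - split; [lia | reflexivity].
  - fold (search h N). destruct (search h N) as [|s] eqn:E.
    + destruct (h N) as [|[|k]] eqn:Eh; (split; [try discriminate|intros H]).
      * destruct (H N) as [k Hk]; [lia|congruence].
      * destruct (H N) as [k Hk]; [lia|congruence].
      * intros _ m Hm. destruct (Nat.eq_dec m N) as [->|]; [eauto|].
        apply IH; [reflexivity|lia].
      * reflexivity.
    + split; [discriminate|]. intros H. apply IH. intros m Hm. apply H. lia.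
Qed.

Lemma search_found h N n :
  search h N = S (S n) <->
  n < N /\ h n = 1 /\ forall m, m < n -> exists k, h m = S (S k).
Proof.
  induction N as [|N IH]; cbn.
  - split; [discriminate|lia].
  - fold (search h N). destruct (search h N) as [|s] eqn:E.
    + pose proof (proj1 (search_zero h N) E) as Hz.
      destruct (h N) as [|[|k]] eqn:Eh; split; try discriminate.
      * intros (Hn & H1 & _). destruct (Nat.eq_dec n N) as [->|]; [congruence|].
        destruct (Hz n) as [k Hk]; [lia|congruence].
      * intros [= ->]. auto.
      * intros (Hn & H1 & _). destruct (Nat.eq_dec n N) as [->|]; [congruence|].
        destruct (Hz n) as [k Hk]; [lia|congruence].
      * intros (Hn & H1 & _). destruct (Nat.eq_dec n N) as [->|]; [congruence|].
        destruct (Hz n) as [k' Hk]; [lia|congruence].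
    + rewrite IH. split; intros (Hn & H1 & H2); (split; [|auto]); [lia|].
      destruct (Nat.eq_dec n N) as [->|]; [|lia].
      apply search_zero in H2. congruence.
Qed.

(** [Nat.pred] in [fuel] merges the outcomes [0] and [1] of [search] into no result and turns
    [S (S n)] into the result [n]. *)
Lemma fuel_mu a f t x n :
  fuel a (cMu f) t x = S n <->
  n < t /\ fuel a f t (npair x n) = 1 /\
  forall m, m < n -> exists k, fuel a f t (npair x m) = S (S k).
Proof.
  rewrite <- (search_found (fun m => fuel a f t (npair x m))).
  cbn [fuel]. fold (search (fun m => fuel a f t (npair x m)) t).
  destruct (search _ t) as [|s]; cbn; split; congruence.
Qed.

Lemma fuel_mono a e t t' x y :
  t <= t' -> fuel a e t x = S y -> fuel a e t' x = S y.
Proof.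
  intros Ht. revert x y.
  induction e as [| | | | | |f IHf g IHg|f IHf g IHg|f IHf g IHg|f IHf];
    intros x y; try (cbn; easy).
  - cbn. destruct (fuel a f t x) as [|u] eqn:Eu; [easy|].
    destruct (fuel a g t x) as [|v] eqn:Ev; [easy|].
    now rewrite (IHf _ _ Eu), (IHg _ _ Ev).
  - cbn. destruct (fuel a g t x) as [|u] eqn:Eu; [easy|].
    rewrite (IHg _ _ Eu). apply IHf.
  - cbn. revert y. induction (pi2 x) as [|n IHn]; intros y; cbn; [apply IHf|].
    destruct (nat_rect _ _ _ n) as [|z]; [easy|].
    rewrite (IHn _ eq_refl). apply IHg.
  - rewrite !fuel_mu. intros (Hn & H1 & H2). repeat split; [lia|auto|].
    intros m Hm. destruct (H2 m Hm) as [k Hk]. eauto.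
Qed.

Lemma fuel_sound a e t x y : fuel a e t x = S y -> eval a e x y.
Proof.
  revert x y.
  induction e as [| | | | | |f IHf g IHg|f IHf g IHg|f IHf g IHg|f IHf];
    intros x y.
  - intros [= <-]. constructor.
  - intros [= <-]. constructor.
  - intros [= <-]. constructor.
  - intros [= <-]. apply eval_fst.
  - intros [= <-]. apply eval_snd.
  - intros [= <-]. constructor.
  - cbn. destruct (fuel a f t x) as [|u] eqn:Eu; [easy|].
    destruct (fuel a g t x) as [|v] eqn:Ev; [easy|].
    intros [= <-]. constructor; auto.
  - cbn. destruct (fuel a g t x) as [|u] eqn:Eu; [easy|].
    intros H. econstructor; eauto.
  - replace (eval a (cRec f g) x y)
      with (eval a (cRec f g) (npair (pi1 x) (pi2 x)) y) by now rewrite npair_pi.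
    cbn. revert y.
    induction (pi2 x) as [|n IHn]; intros y; cbn.
    + rewrite eval_rec0_iff. apply IHf.
    + destruct (nat_rect _ _ _ n) as [|z]; [easy|].
      rewrite eval_recS_iff. eauto.
  - rewrite fuel_mu, eval_mu_iff. intros (Hn & H1 & H2). split; [auto|].
    intros m Hm. destruct (H2 m Hm) as [k Hk]. eauto.
Qed.

(** Gives a single bound for the finitely many runs that precede the zero found by [cMu]. *)
Lemma common_fuel (P : nat -> nat -> Prop) N :
  (forall m t t', t <= t' -> P m t -> P m t') ->
  (forall m, m < N -> exists t, P m t) ->
  exists t, forall m, m < N -> P m t.
Proof.
  intros Hmono. induction N as [|N IH]; intros H.
  - exists 0. lia.
  - destruct IH as [t Ht]; [auto|]. destruct (H N) as [t' Ht']; [lia|].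
    exists (Nat.max t t'). intros m Hm. destruct (Nat.eq_dec m N) as [->|].
    + eapply Hmono; [|eassumption]. lia.
    + apply (Hmono m t); [lia|]. apply Ht. lia.
Qed.

Lemma fuel_complete a e x y : eval a e x y -> exists t, fuel a e t x = S y.
Proof.
  revert x y.
  induction e as [| | | | | |f IHf g IHg|f IHf g IHg|f IHf g IHg|f IHf];
    intros x y H;
    try (eval_base H; exists 0; cbn; npair_simpl; reflexivity).
  - apply eval_pair_iff in H as (u & v & -> & Hu & Hv).
    destruct (IHf _ _ Hu) as [t Ht], (IHg _ _ Hv) as [t' Ht'].
    exists (Nat.max t t'). cbn.
    rewrite (fuel_mono _ _ t _ _ u), (fuel_mono _ _ t' _ _ v); auto; lia.
  - apply eval_comp_iff in H as (u & Hu & Hv).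
    destruct (IHg _ _ Hu) as [t Ht], (IHf _ _ Hv) as [t' Ht'].
    exists (Nat.max t t'). cbn.
    rewrite (fuel_mono _ _ t _ _ u) by (assumption || lia).
    apply (fuel_mono _ _ t'); [lia|assumption].
  - rewrite <- (npair_pi x) in *. revert y H. generalize (pi1 x) as u. intros u.
    induction (pi2 x) as [|n IHn]; intros y H.
    + apply eval_rec0_iff in H. destruct (IHf _ _ H) as [t Ht].
      exists t. cbn. npair_simpl. exact Ht.
    + apply eval_recS_iff in H as (z & Hz & Hy).
      destruct (IHn _ Hz) as [t Ht], (IHg _ _ Hy) as [t' Ht'].
      exists (Nat.max t t').
      apply (fuel_mono _ _ _ (Nat.max t t')) in Ht; [|lia].
      apply (fuel_mono _ _ _ (Nat.max t t')) in Ht'; [|lia].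
      cbn in Ht |- *. npair_simpl. cbn. now rewrite Ht.
  - apply eval_mu_iff in H as [H1 H2].
    destruct (IHf _ _ H1) as [t Ht].
    destruct (common_fuel (fun m t => exists k, fuel a f t (npair x m) = S (S k)) y)
      as [t' Ht'].
    + intros m s s' Hs [k Hk]. exists k. now apply (fuel_mono _ _ s).
    + intros m Hm. destruct (H2 m Hm) as [k Hk]. destruct (IHf _ _ Hk). eauto.
    (* The bound must also exceed [y], since only positions below it are searched. *)
    + exists (Nat.max (S y) (Nat.max t t')). apply fuel_mu. repeat split; [lia| |].
      * apply (fuel_mono _ _ t); [lia|assumption].
      * intros m Hm. destruct (Ht' m Hm) as [k Hk]. exists k.
        apply (fuel_mono _ _ t'); [lia|assumption].
Qed.

(** * Total computable functions *)

(** The type [A] is a type of parameters, each of which carries an oracle: this allows total functions whose definition makes sense only for some oracles. *)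
Definition computable {A : Type} (orc F : A -> nat -> nat) : Prop :=
  exists e, forall a x, eval (orc a) e x (F a x).

Lemma comp_ext {A} (orc F G : A -> nat -> nat) :
  (forall a x, F a x = G a x) -> computable orc F -> computable orc G.
Proof. intros E [e He]. exists e. intros a x. rewrite <- E. apply He. Qed.

Lemma comp_id {A} (orc : A -> nat -> nat) : computable orc (fun _ x => x).
Proof. exists cId. constructor. Qed.

Lemma comp_app {A} (orc F G : A -> nat -> nat) :
  computable orc F -> computable orc G -> computable orc (fun a x => F a (G a x)).
Proof. intros [e He] [f Hf]. exists (cComp e f). econstructor; eauto. Qed.

Lemma comp_S {A} (orc F : A -> nat -> nat) :
  computable orc F -> computable orc (fun a x => S (F a x)).
Proof. intros [e He]. exists (cComp cSucc e). econstructor; [eauto|constructor]. Qed.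

Lemma comp_const {A} (orc : A -> nat -> nat) c : computable orc (fun _ _ => c).
Proof. induction c; [exists cZero; constructor | now apply comp_S]. Qed.

Lemma comp_oracle {A} (orc F : A -> nat -> nat) :
  computable orc F -> computable orc (fun a x => orc a (F a x)).
Proof. apply comp_app. exists cOracle. constructor. Qed.

Lemma comp_pi1 {A} (orc F : A -> nat -> nat) :
  computable orc F -> computable orc (fun a x => pi1 (F a x)).
Proof. apply (comp_app orc (fun _ => pi1)). exists cFst. intros. apply eval_fst. Qed.

Lemma comp_pi2 {A} (orc F : A -> nat -> nat) :
  computable orc F -> computable orc (fun a x => pi2 (F a x)).
Proof. apply (comp_app orc (fun _ => pi2)). exists cSnd. intros. apply eval_snd. Qed.

Lemma comp_npair {A} (orc F G : A -> nat -> nat) :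
  computable orc F -> computable orc G ->
  computable orc (fun a x => npair (F a x) (G a x)).
Proof. intros [e He] [f Hf]. exists (cPair e f). now constructor. Qed.

Lemma comp_rec {A} (orc B N : A -> nat -> nat) (G : A -> nat -> nat -> nat -> nat) :
  computable orc B ->
  computable orc (fun a m => G a (pi1 m) (pi1 (pi2 m)) (pi2 (pi2 m))) ->
  computable orc N ->
  computable orc
    (fun a x => nat_rect (fun _ => nat) (B a x) (fun n z => G a x n z) (N a x)).
Proof.
  intros [b Hb] [g Hg] [k Hk]. exists (cComp (cRec b g) (cPair cId k)). intros a x.
  econstructor; [constructor; [constructor|apply Hk]|].
  induction (N a x) as [|n IHn]; cbn; [now constructor|].
  econstructor; [exact IHn|].
  specialize (Hg a (npair x (npair n (nat_rect (fun _ => nat) (B a x) (G a x) n)))).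
  now rewrite pi1_npair, !pi2_npair, pi1_npair in Hg.
Qed.

(** A case distinction is a recursion that ignores the previous value. *)
Lemma comp_case {A} (orc Z B : A -> nat -> nat) (K : A -> nat -> nat -> nat) :
  computable orc Z -> computable orc B ->
  computable orc (fun a m => K a (pi1 m) (pi2 m)) ->
  computable orc (fun a x => match Z a x with 0 => B a x | S y => K a x y end).
Proof.
  intros HZ HB HK.
  apply (comp_ext orc
    (fun a x => nat_rect (fun _ => nat) (B a x) (fun n _ => K a x n) (Z a x))).
  { intros a x. now destruct (Z a x). }
  apply (comp_rec orc B Z (fun a x n _ => K a x n)); auto.
  apply (comp_ext orc
    (fun a m => K a (pi1 (npair (pi1 m) (pi1 (pi2 m))))
                    (pi2 (npair (pi1 m) (pi1 (pi2 m)))))).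
  { intros a m. now rewrite pi1_npair, pi2_npair. }
  apply (comp_app orc (fun a m => K a (pi1 m) (pi2 m))); [exact HK|].
  apply comp_npair; [|apply comp_pi1, comp_pi2]; try apply comp_pi1; apply comp_id.
Qed.

Lemma comp_pred {A} (orc F : A -> nat -> nat) :
  computable orc F -> computable orc (fun a x => Nat.pred (F a x)).
Proof.
  intros HF.
  apply (comp_ext orc (fun a x => match F a x with 0 => 0 | S y => y end)).
  { intros a x. now destruct (F a x). }
  apply (comp_case orc F (fun _ _ => 0) (fun _ _ y => y)).
  - exact HF.
  - apply comp_const.
  - apply comp_pi2, comp_id.
Qed.

Lemma comp_add {A} (orc F G : A -> nat -> nat) :
  computable orc F -> computable orc G -> computable orc (fun a x => F a x + G a x).
Proof.
  intros HF HG.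
  apply (comp_ext orc
    (fun a x => nat_rect (fun _ => nat) (G a x) (fun _ z => S z) (F a x))).
  { intros a x. induction (F a x); cbn; congruence. }
  apply (comp_rec orc G F (fun _ _ _ z => S z)); auto.
  apply comp_S, comp_pi2, comp_pi2, comp_id.
Qed.

Lemma comp_sub {A} (orc F G : A -> nat -> nat) :
  computable orc F -> computable orc G -> computable orc (fun a x => F a x - G a x).
Proof.
  intros HF HG.
  apply (comp_ext orc
    (fun a x => nat_rect (fun _ => nat) (F a x) (fun _ z => Nat.pred z) (G a x))).
  { intros a x. induction (G a x); cbn; lia. }
  apply (comp_rec orc F G (fun _ _ _ z => Nat.pred z)); auto.
  apply comp_pred, comp_pi2, comp_pi2, comp_id.
Qed.

Lemma comp_mul {A} (orc F G : A -> nat -> nat) :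
  computable orc F -> computable orc G -> computable orc (fun a x => F a x * G a x).
Proof.
  intros HF HG.
  apply (comp_ext orc
    (fun a x => nat_rect (fun _ => nat) 0 (fun _ z => G a x + z) (F a x))).
  { intros a x. induction (F a x); cbn; congruence. }
  apply (comp_rec orc (fun _ _ => 0) F (fun a x _ z => G a x + z)); auto.
  - apply comp_const.
  - apply comp_add; [|apply comp_pi2, comp_pi2, comp_id].
    apply comp_app; [exact HG|]. apply comp_pi1, comp_id.
Qed.

Lemma comp_odd {A} (orc F : A -> nat -> nat) :
  computable orc F -> computable orc (fun a x => Nat.b2n (Nat.odd (F a x))).
Proof.
  intros HF.
  apply (comp_ext orc
    (fun a x => nat_rect (fun _ => nat) 0 (fun _ z => 1 - z) (F a x))).
  { intros a x. induction (F a x) as [|n IHn]; [reflexivity|].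
    cbn [nat_rect]. rewrite IHn, Nat.odd_succ, <- Nat.negb_odd.
    now destruct (Nat.odd n). }
  apply (comp_rec orc (fun _ _ => 0) F (fun _ _ _ z => 1 - z)); auto.
  - apply comp_const.
  - apply comp_sub; [apply comp_const|]. apply comp_pi2, comp_pi2, comp_id.
Qed.

Lemma comp_div2 {A} (orc F : A -> nat -> nat) :
  computable orc F -> computable orc (fun a x => Nat.div2 (F a x)).
Proof.
  intros HF.
  apply (comp_ext orc (fun a x =>
    nat_rect (fun _ => nat) 0 (fun n z => Nat.b2n (Nat.odd n) + z) (F a x))).
  { intros a x. induction (F a x) as [|n IHn]; [reflexivity|].
    cbn [nat_rect]. rewrite IHn.
    pose proof (Nat.div2_odd n). pose proof (Nat.div2_odd (S n)) as H'.
    rewrite Nat.odd_succ, <- Nat.negb_odd in H'. destruct (Nat.odd n); cbn in *; lia. }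
  apply (comp_rec orc (fun _ _ => 0) F (fun _ _ n z => Nat.b2n (Nat.odd n) + z)); auto.
  - apply comp_const.
  - apply comp_add; [apply comp_odd, comp_pi1|]; apply comp_pi2; [|apply comp_pi2];
      apply comp_id.
Qed.

Ltac comp_step :=
  match goal with
  | H : computable ?orc _ |- computable ?orc _ => exact H
  | _ => first
    [ apply comp_id | apply comp_const | apply comp_pi1 | apply comp_pi2
    | apply comp_npair | apply comp_pred | apply comp_add | apply comp_sub
    | apply comp_mul | apply comp_odd | apply comp_div2 | apply comp_S
    | apply comp_oracle
    | match goal with
      | H : computable ?orc ?F |- computable ?orc _ => apply (comp_app orc F _ H)
      end
    | apply comp_case | apply comp_rec ]
  end.
Ltac computability := repeat comp_step.

(** The program [e] is fixed, so induction on it takes the place of a universal program. [T] and [F]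
    stay general because subprograms run on derived inputs. *)
Lemma comp_fuel {A} (orc O : A -> nat -> nat) e :
  computable orc O -> forall T F, computable orc T -> computable orc F ->
  computable orc (fun a x => fuel (O a) e (T a x) (F a x)).
Proof.
  intros HO. induction e; intros T F HT HF; cbn [fuel]; computability.
  - apply IHe1; computability.
  - apply IHe2; computability.
  - apply IHe2; computability.
  - apply IHe1; computability.
  - apply IHe1; computability.
  - apply IHe2; computability.
  - apply IHe; computability.
Qed.

Lemma eval_mu_total a f x F :
  (forall m, eval a f (npair x m) (F m)) ->
  (exists y, eval a (cMu f) x y) <-> exists n, F n = 0.
Proof.
  intros Hf. split.
  - intros [n Hn]. apply eval_mu_iff in Hn as [Hn _]. exists n.
    exact (eval_det _ _ _ _ _ (Hf n) Hn).
  (* Strong induction descends to the least zero, below which all values are positive. *)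
  - intros [n Hn]. revert Hn. induction (lt_wf n) as [n _ IHn]. intros Hn.
    destruct (classic (exists m, m < n /\ F m = 0)) as [(m & L & Hm)|H]; [eauto|].
    exists n. constructor; [rewrite <- Hn; apply Hf|].
    intros m L. exists (pred (F m)).
    destruct (F m) eqn:E; [exfalso; eauto|]. cbn. rewrite <- E. apply Hf.
Qed.

(** Choice names the outcome of the halting search as [F], and the program [cMu e] computes it. *)
Lemma comp_mu {A} (orc G : A -> nat -> nat) :
  computable orc G -> (forall a x, exists n, G a (npair x n) = 0) ->
  exists F, computable orc F /\ forall a x, G a (npair x (F a x)) = 0.
Proof.
  intros [e He] HG.
  assert (H : forall a x, exists y, eval (orc a) (cMu e) x y).
  { intros a x. apply (eval_mu_total _ _ _ (fun n => G a (npair x n))); auto. }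
  exists (fun a x => proj1_sig (constructive_indefinite_description _ (H a x))).
  split.
  - exists (cMu e). intros a x. apply proj2_sig.
  - intros a x. destruct constructive_indefinite_description as [y Hy]. cbn.
    apply eval_mu_iff in Hy as [Hy _]. exact (eval_det _ _ _ _ _ (He _ _) Hy).
Qed.

(** * Codes of binary strings *)

Lemma code_str_inj s s' : code_str s = code_str s' -> s = s'.
Proof.
  revert s'. induction s as [|b s IH]; intros [|b' s']; cbn [code_str]; intros H;
    try reflexivity; try (destruct b, b'; lia); try (destruct b; lia);
    try (destruct b'; lia).
  destruct b, b'; try lia; f_equal; apply IH; lia.
Qed.

(** [code_str] is bijective base two with digits [1] and [2], least significant digit first. A sigma
    type lets [decode] extract the string. *)
Lemma code_str_surj c : {s | code_str s = c}.
Proof.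
  induction c as [c IH] using (well_founded_induction_type lt_wf).
  destruct c as [|c]; [now exists []|].
  destruct (IH (Nat.div2 c)) as [s Hs].
  { pose proof (Nat.div2_decr c c). lia. }
  exists (Nat.odd c :: s). cbn [code_str]. rewrite Hs.
  pose proof (Nat.div2_odd c). destruct (Nat.odd c); cbn in *; lia.
Qed.

Definition decode (c : nat) : list bool := proj1_sig (code_str_surj c).

Lemma code_decode c : code_str (decode c) = c.
Proof. exact (proj2_sig (code_str_surj c)). Qed.

Lemma decode_code s : decode (code_str s) = s.
Proof. apply code_str_inj, code_decode. Qed.

Lemma code_app s u : code_str (s ++ u) = code_str s + 2 ^ length s * code_str u.
Proof. induction s as [|b s IH]; cbn [app code_str length Nat.pow]; [lia|]. rewrite IH. lia. Qed.

Lemma code_bounds s : 2 ^ length s <= S (code_str s) < 2 ^ S (length s).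
Proof.
  induction s as [|b s IH]; cbn [code_str length Nat.pow] in *; [lia|].
  destruct b; lia.
Qed.

(** The largest power of two not exceeding [S c]. Codes of strings of length [l] fill the block from
    [2^l - 1] to [2^(l+1) - 2], so this is two to the length of the coded string. *)
Definition strpow (c : nat) : nat :=
  nat_rect (fun _ => nat) 1
    (fun n z => match z + z - S (S n) with 0 => z + z | S _ => z end) c.

Lemma strpow_code s : strpow (code_str s) = 2 ^ length s.
Proof.
  assert (H : forall c, exists l, strpow c = 2 ^ l /\ 2 ^ l <= S c < 2 ^ S l).
  { induction c as [|c (l & E & H)]; [exists 0; cbn; lia|].
    cbn. fold (strpow c). rewrite E. cbn [Nat.pow] in *.
    destruct (2 ^ l + 2 ^ l - S (S c)) eqn:D.
    - exists (S l). cbn [Nat.pow]. lia.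
    - exists l. lia. }
  destruct (H (code_str s)) as (l & -> & Hl).
  rewrite <- (Nat.log2_unique _ l (Nat.le_0_l _) Hl).
  now rewrite (Nat.log2_unique _ _ (Nat.le_0_l _) (code_bounds s)).
Qed.

(** The instance of [code_app] for a one-bit string, whose code is [S b]. *)
Definition snoc (c b : nat) : nat := c + strpow c * S b.

Lemma code_snoc s b : code_str (s ++ [b]) = snoc (code_str s) (Nat.b2n b).
Proof. unfold snoc. rewrite code_app, strpow_code. now destruct b. Qed.

Lemma decode_snoc c b : decode (snoc c (Nat.b2n b)) = decode c ++ [b].
Proof. rewrite <- (code_decode c) at 1. now rewrite <- code_snoc, decode_code. Qed.

Definition zeros (c n : nat) : nat :=
  nat_rect (fun _ => nat) c (fun _ z => snoc z 0) n.

Lemma decode_zeros c n : decode (zeros c n) = decode c ++ repeat false n.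
Proof.
  induction n as [|n IHn]; cbn [zeros nat_rect]; [now rewrite app_nil_r|].
  fold (zeros c n). rewrite (decode_snoc _ false), IHn, <- app_assoc.
  now rewrite <- repeat_cons.
Qed.

(** One less than a nonzero code has the head as parity and the code of the tail as half. Code [0]
    reproduces itself with parity zero, which matches the default [false] of [nth]. *)
Definition bit (c n : nat) : nat :=
  Nat.b2n (Nat.odd (Nat.pred
    (nat_rect (fun _ => nat) c (fun _ z => Nat.div2 (Nat.pred z)) n))).

Lemma bit_code s n : bit (code_str s) n = Nat.b2n (nth n s false).
Proof.
  unfold bit. do 2 f_equal.
  assert (H : forall n, nat_rect (fun _ => nat) (code_str s)
    (fun _ z => Nat.div2 (Nat.pred z)) n = code_str (skipn n s)).
  { clear n. induction n as [|n IHn]; [reflexivity|].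
    cbn [nat_rect]. rewrite IHn. clear IHn. revert s.
    induction n as [|n IHn]; intros [|b s]; try reflexivity.
    - cbn [skipn code_str].
      replace (Nat.pred _) with (Nat.b2n b + 2 * code_str s) by (destruct b; cbn; lia).
      now rewrite Nat.div2_div, Nat.add_b2n_double_div2.
    - apply IHn. }
  rewrite H. clear H. revert n.
  induction s as [|b s IH]; intros [|n]; try reflexivity.
  - cbn [skipn code_str nth].
    replace (Nat.pred _) with (Nat.b2n b + 2 * code_str s) by (destruct b; cbn; lia).
    rewrite Nat.odd_add_mul_2. now destruct b.
  - apply IH.
Qed.

(** * Random sequences *)

Definition bname (X : cantor) (n : nat) : nat := if X n then 1 else 0.

Definition scons (b : bool) (X : cantor) : cantor :=
  fun n => match n with 0 => b | S m => X m end.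

Definition append (s : list bool) (X : cantor) : cantor := fold_right scons X s.

Lemma nth_prefix X n k : k < n -> nth k (prefix X n) false = X k.
Proof.
  intros H. unfold prefix. rewrite nth_indep with (d' := X 0) by now rewrite length_map, length_seq.
  rewrite map_nth, seq_nth by assumption. reflexivity.
Qed.

Lemma length_prefix X n : length (prefix X n) = n.
Proof. unfold prefix. now rewrite length_map, length_seq. Qed.

Lemma prefix_S X n : prefix X (S n) = prefix X n ++ [X n].
Proof. unfold prefix. now rewrite seq_S, map_app. Qed.

Lemma has_prefix_prefix X n Y :
  has_prefix (prefix X n) Y <-> forall k, k < n -> X k = Y k.
Proof.
  unfold has_prefix. rewrite length_prefix.
  split; intros H k Hk; specialize (H k Hk); now rewrite nth_prefix in *.
Qed.

Lemma prefix_const_false n : prefix (fun _ => false) n = repeat false n.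
Proof.
  induction n as [|n IHn]; [reflexivity|]. rewrite prefix_S, IHn.
  cbn. now rewrite repeat_cons.
Qed.

Lemma has_prefix_app s u Y : has_prefix (s ++ u) Y -> has_prefix s Y.
Proof.
  intros H k Hk. rewrite <- H by (rewrite length_app; lia). now rewrite app_nth1.
Qed.

Lemma cyl_sub_app s u A : cyl_sub s A -> cyl_sub (s ++ u) A.
Proof. intros H Y HY. apply H. eapply has_prefix_app, HY. Qed.

Lemma has_prefix_scons b s Y : has_prefix (b :: s) (scons b Y) <-> has_prefix s Y.
Proof.
  split; intros H k Hk.
  - apply (H (S k)). cbn. lia.
  - destruct k; [reflexivity|]. apply H. cbn in Hk. lia.
Qed.

Lemma cyl_sub_scons b s A :
  cyl_sub s (fun Y => A (scons b Y)) <-> cyl_sub (b :: s) A.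
Proof.
  split; intros H Y HY.
  - assert (E : Y = scons b (fun n => Y (S n))).
    { apply functional_extensionality. intros [|n]; [|reflexivity].
      symmetry. apply (HY 0). cbn. lia. }
    rewrite E in HY |- *. apply H. now apply has_prefix_scons in HY.
  - apply H. now apply has_prefix_scons.
Qed.

Lemma nth_append_prefix s X n k :
  k < length s + n -> nth k (s ++ prefix X n) false = append s X k.
Proof.
  revert k. induction s as [|b s IH]; intros k Hk; [now apply nth_prefix|].
  destruct k; [reflexivity|]. apply IH. cbn in Hk. lia.
Qed.

Lemma has_prefix_append s X n : has_prefix (s ++ prefix X n) (append s X).
Proof.
  intros k Hk. apply nth_append_prefix. now rewrite length_app, length_prefix in Hk.
Qed.

(** * Tests and finite modifications of random sequences *)

Definition index_set (V : nat -> cantor -> Prop) (m : nat) : Prop :=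
  exists i s, m = npair i (code_str s) /\ cyl_sub s (V i).

(** Pairing and string coding are bijective, so enumerability can be checked at each pair of a level
    and a string. *)
Lemma ce_index_set V e :
  (forall m, index_set V m <-> exists y, eval (fun _ => 0) e m y) <->
  (forall i s, cyl_sub s (V i) <-> exists y, eval (fun _ => 0) e (npair i (code_str s)) y).
Proof.
  split; intros H.
  - intros i s. rewrite <- H. split; [intros Hs; now exists i, s|].
    intros (i' & s' & E & Hs). apply npair_inj in E as [-> E].
    now rewrite (code_str_inj _ _ E).
  - intros m. rewrite <- (npair_pi m), <- (code_decode (pi2 m)), <- H.
    split; [|intros Hs; now exists (pi1 m), (decode (pi2 m))].
    intros (i' & s' & E & Hs). apply npair_inj in E as [-> E].
    now rewrite (code_str_inj _ _ E).
Qed.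

(** A test capturing [scons b X] is pulled back along prepending [b]. This at most doubles the
    measure of a level, which the shift to level [S i] compensates. *)
Lemma MLR_scons b X : MLR X -> MLR (scons b X).
Proof.
  intros HX V (Hopen & [e He] & Hmeas) HV.
  apply (HX (fun i Y => V (S i) (scons b Y))); [|intros i; apply HV].
  split; [|split].
  - intros i Y HY. destruct (Hopen _ _ HY) as [n Hn]. exists n. intros Y' HY'.
    apply Hn. rewrite has_prefix_prefix in HY' |- *.
    intros [|k] Hk; [reflexivity|]. apply HY'. lia.
  - destruct (comp_npair (fun (_ : unit) _ => 0)
      (fun _ m => S (pi1 m)) (fun _ m => 2 * pi2 m + 1 + if b then 1 else 0))
      as [g Hg]; [computability..|].
    exists (cComp e g). apply ce_index_set. intros i s.
    setoid_rewrite (eval_comp_val _ _ _ _ _ _ (Hg tt _)).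
    rewrite pi1_npair, pi2_npair, cyl_sub_scons.
    exact (proj1 (ce_index_set V e) He (S i) (b :: s)).
  - intros i n L HL Hin. specialize (Hmeas (S i) (S n) (map (cons b) L)).
    rewrite length_map in Hmeas. cbn [Nat.pow] in Hmeas.
    (* Prepending [b] raises the length and the level by one each, so both sides carry a factor
       two. *)
    enough (length L * (2 * 2 ^ i) <= 2 * 2 ^ n) by lia.
    apply Hmeas.
    + apply FinFun.Injective_map_NoDup; [|assumption]. intros x y E. congruence.
    + intros t Ht. apply in_map_iff in Ht as (s & <- & Hs).
      destruct (Hin s Hs) as [Hl Hc]. split; [cbn; congruence|].
      now apply cyl_sub_scons.
Qed.

Lemma MLR_append s X : MLR X -> MLR (append s X).
Proof. intros HX. induction s as [|b s IH]; [assumption|]. now apply MLR_scons. Qed.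

(** * Cylinders and sequences ending in zeros *)

Lemma cyl_sub_cylinder s t : cyl_sub s (has_prefix t) <-> exists u, s = t ++ u.
Proof.
  split.
  - intros H.
    assert (Hl : length t <= length s).
    { destruct (le_lt_dec (length t) (length s)) as [|L]; [assumption|exfalso].
      (* [Y] continues [s] by the opposite of the bits of [t], so it cannot extend a [t] longer than
         [s]. *)
      pose (Y := fun k => if k <? length s then nth k s false else negb (nth k t false)).
      assert (HY : has_prefix t Y).
      { apply H. intros k Hk. unfold Y. now rewrite (proj2 (Nat.ltb_lt _ _) Hk). }
      specialize (HY _ L). unfold Y in HY. rewrite Nat.ltb_irrefl in HY.
      now destruct (nth _ t _). }
    assert (Ht : has_prefix t (fun k => nth k s false)) by (apply H; now intros k _).
    exists (skipn (length t) s). rewrite <- (firstn_skipn (length t) s) at 1. f_equal.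
    apply nth_ext with false false; [rewrite length_firstn; lia|].
    intros k Hk. rewrite length_firstn in Hk. rewrite nth_firstn.
    rewrite (proj2 (Nat.ltb_lt k (length t))) by lia.
    symmetry. apply Ht. lia.
  - intros [u ->] Y. apply has_prefix_app.
Qed.

Fixpoint strings (n : nat) : list (list bool) :=
  match n with
  | 0 => [[]]
  | S n' => map (cons true) (strings n') ++ map (cons false) (strings n')
  end.

Lemma length_strings n : length (strings n) = 2 ^ n.
Proof.
  induction n as [|n IHn]; [reflexivity|].
  cbn. rewrite length_app, !length_map, IHn. lia.
Qed.

Lemma in_strings s : In s (strings (length s)).
Proof.
  induction s as [|b s IH]; [now left|].
  cbn. apply in_or_app. destruct b; [left|right]; now apply in_map.
Qed.

Lemma measure_le_cylinder t i : i <= length t -> measure_le (has_prefix t) i.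
Proof.
  intros Hi n L HL Hin.
  assert (Hext : forall s, In s L -> exists u, s = t ++ u /\ length u = n - length t).
  { intros s Hs. destruct (Hin s Hs) as [Hl Hc].
    apply cyl_sub_cylinder in Hc as [u ->]. exists u. split; [reflexivity|].
    rewrite length_app in Hl. lia. }
  (* Only a nonempty [L] forces [length t <= n], without which the truncated [n - length t]
     miscounts. *)
  destruct L as [|s0 L0]; [cbn; lia|].
  assert (Hn : length t <= n).
  { destruct (Hin s0 (or_introl eq_refl)) as [Hl Hc].
    apply cyl_sub_cylinder in Hc as [u ->]. rewrite length_app in Hl. lia. }
  assert (Hc : length (s0 :: L0) <= 2 ^ (n - length t)).
  { rewrite <- length_strings, <- (length_map (app t) (strings _)).
    apply NoDup_incl_length; [assumption|].
    intros s Hs. destruct (Hext s Hs) as (u & -> & Hu).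
    apply in_map. rewrite <- Hu. apply in_strings. }
  transitivity (2 ^ (n - length t) * 2 ^ i); [now apply Nat.mul_le_mono_r|].
  rewrite <- Nat.pow_add_r. apply Nat.pow_le_mono_r; lia.
Qed.

(** Every level contains [s] followed by zeros, so a universal test has to capture that sequence as
    well. *)
Lemma ML_test_zeros s : ML_test (fun i => has_prefix (s ++ repeat false i)).
Proof.
  split; [|split].
  - intros i X HX. exists (length (s ++ repeat false i)). intros Y HY k Hk.
    rewrite has_prefix_prefix in HY. rewrite <- HY by assumption. auto.
  (* The two truncated differences add up to the distance between the given code and that of [s],
     then [i] zeros, then the string with code [pi2 m]; [cMu] looks for such a string. *)
  - destruct (comp_add (fun (_ : unit) _ => 0)
      (fun _ m => pi2 (pi1 m) - (zeros (code_str s) (pi1 (pi1 m))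
         + strpow (zeros (code_str s) (pi1 (pi1 m))) * pi2 m))
      (fun _ m => (zeros (code_str s) (pi1 (pi1 m))
         + strpow (zeros (code_str s) (pi1 (pi1 m))) * pi2 m) - pi2 (pi1 m)))
      as [g Hg]; [computability..|].
    exists (cMu g). apply ce_index_set. intros i r.
    rewrite (eval_mu_total _ _ _ _ (fun m => Hg tt _)).
    rewrite cyl_sub_cylinder.
    assert (E : zeros (code_str s) i = code_str (s ++ repeat false i)).
    { now rewrite <- (code_decode (zeros _ i)), decode_zeros, decode_code. }
    split.
    + intros [u ->]. exists (code_str u). npair_simpl.
      rewrite E, strpow_code, code_app. lia.
    + intros [u Hu]. npair_simpl. rewrite E, strpow_code in Hu.
      exists (decode u). apply code_str_inj. rewrite code_app, code_decode. lia.
  - intros i. apply measure_le_cylinder. rewrite length_app, repeat_length. lia.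
Qed.

(** Universality puts [s] followed by zeros into [U m], and openness yields a finite prefix whose
    cylinder suffices. *)
Lemma universal_contains_zeros U s m :
  universal_ML_test U -> exists n, cyl_sub (s ++ repeat false n) (U m).
Proof.
  intros [(Hopen & _) HU].
  assert (H : U m (append s (fun _ => false))).
  { apply (HU _ (ML_test_zeros s)). intros i. rewrite <- prefix_const_false.
    apply has_prefix_append. }
  destruct (Hopen _ _ H) as [n Hn]. exists n. intros Y HY. apply Hn.
  apply has_prefix_prefix. intros k Hk.
  rewrite <- prefix_const_false in HY.
  rewrite <- (nth_append_prefix _ _ n) by lia. apply HY.
  rewrite length_app, length_prefix. lia.
Qed.

(** * Membership in a test from a name *)

Lemma comp_prefix {A} (orc : A -> nat -> nat) (X : A -> cantor) :
  computable orc (fun a => bname (X a)) ->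
  computable orc (fun a n => code_str (prefix (X a) n)).
Proof.
  intros HX.
  apply (comp_ext orc (fun a n =>
    nat_rect (fun _ => nat) 0 (fun k z => snoc z (bname (X a) k)) n)).
  - intros a n. induction n as [|n IHn]; [reflexivity|].
    cbn [nat_rect]. rewrite IHn, prefix_S, code_snoc. reflexivity.
  - computability.
Qed.

(** Membership in an open set shows in a finite prefix, so the enumeration of the test is run on
    prefixes of [X]. It refers to the zero oracle, which [subst_oracle cZero] simulates over
    [bname X]. *)
Lemma membership_code U :
  ML_test U ->
  exists e, forall X i,
    U i X <-> exists n y, eval (bname X) e (npair i n) y.
Proof.
  intros (Hopen & [e He] & _).
  destruct (comp_prefix bname (fun X => X)) as [g Hg]; [exists cOracle; constructor|].
  exists (cComp (cComp (subst_oracle cZero e) (cPair cZero cId))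
                (cPair cFst (cComp g cSnd))).
  intros X i.
  assert (E : forall n y,
    eval (bname X) (cComp (cComp (subst_oracle cZero e) (cPair cZero cId))
                          (cPair cFst (cComp g cSnd))) (npair i n) y <->
    eval (fun _ => 0) e (npair i (code_str (prefix X n))) y).
  { intros n y.
    rewrite (eval_comp_val _ _ _ _ (npair i (code_str (prefix X n)))).
    2:{ constructor; [constructor|]. econstructor; [constructor|]. apply Hg. }
    rewrite (eval_comp_val _ _ _ _ (npair 0 (npair i (code_str (prefix X n)))))
      by (repeat constructor).
    apply eval_subst_oracle. constructor. }
  setoid_rewrite E. setoid_rewrite <- (proj1 (ce_index_set U e) He i).
  split; [apply Hopen|]. intros [n Hn]. apply Hn. now apply has_prefix_prefix.
Qed.

(** * Finitely many changes of guess *)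

Section MindChanges.

Context (U : nat -> cantor -> Prop) (X : cantor) (refutes : nat -> nat -> Prop).
Context (str : nat -> list bool) (cnt guess : nat -> nat).

(** Stage [t] examines the evidence [pi2 t], so that all evidence is examined at arbitrarily late stages. *)
Definition switch_at (t : nat) : Prop := refutes (guess t) (pi2 t).

Context (str_0 : str 0 = []) (cnt_0 : cnt 0 = 0) (guess_0 : guess 0 = 0).
Context (copy : forall t, ~ switch_at t ->
  str (S t) = str t ++ [X (cnt t)] /\ cnt (S t) = S (cnt t) /\ guess (S t) = guess t).
(** The leading [false] makes each switch lengthen the string, whatever padding is required. *)
Context (switch : forall t, switch_at t ->
  (exists u, str (S t) = str t ++ false :: u) /\
  (forall m, m <= t -> cyl_sub (str (S t)) (U m)) /\
  cnt (S t) = 0 /\ guess (S t) = S (guess t)).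

(** By stage [S m] the string has more than [m] bits, so the default is never read. *)
Definition limit : cantor := fun m => nth m (str (S m)) false.

Lemma str_extends t d : exists u, str (d + t) = str t ++ u.
Proof.
  induction d as [|d [u Hu]]; [exists []; now rewrite app_nil_r|].
  cbn. destruct (classic (switch_at (d + t))) as [H|H].
  - destruct (switch _ H) as [[v ->] _]. rewrite Hu, <- app_assoc. eauto.
  - destruct (copy _ H) as [-> _]. rewrite Hu, <- app_assoc. eauto.
Qed.

Lemma str_length t : t <= length (str t).
Proof.
  induction t as [|t IH]; [lia|].
  destruct (classic (switch_at t)) as [H|H].
  - destruct (switch _ H) as [[v ->] _]. rewrite length_app. cbn. lia.
  - destruct (copy _ H) as [-> _]. rewrite length_app. cbn. lia.
Qed.

Lemma str_prefix_limit t : has_prefix (str t) limit.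
Proof.
  intros k Hk. unfold limit.
  pose proof (str_length (S k)) as Hl.
  destruct (le_lt_dec t (S k)) as [L|L].
  - destruct (str_extends t (S k - t)) as [u Hu].
    replace (S k - t + t) with (S k) in Hu by lia.
    rewrite Hu. now rewrite app_nth1.
  - destruct (str_extends (S k) (t - S k)) as [u Hu].
    replace (t - S k + S k) with t in Hu by lia.
    rewrite Hu, app_nth1 by lia. reflexivity.
Qed.

Lemma str_shape t : exists s, str t = s ++ prefix X (cnt t).
Proof.
  induction t as [|t [s Hs]]; [exists []; now rewrite str_0, cnt_0|].
  destruct (classic (switch_at t)) as [H|H].
  (* A switch resets the count, so the whole string then serves as [s]. *)
  - destruct (switch _ H) as (_ & _ & -> & _). exists (str (S t)).
    now rewrite app_nil_r.
  - destruct (copy _ H) as (-> & -> & _). exists s.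
    now rewrite Hs, prefix_S, app_assoc.
Qed.

Lemma copying_forever T s :
  str T = s ++ prefix X (cnt T) -> (forall t, T <= t -> ~ switch_at t) ->
  limit = append s X.
Proof.
  intros Hs HT.
  assert (H : forall d, str (d + T) = s ++ prefix X (d + cnt T) /\ cnt (d + T) = d + cnt T).
  { induction d as [|d [IH1 IH2]]; [auto|].
    destruct (copy (d + T)) as (E1 & E2 & _); [apply HT; lia|]. cbn [Nat.add].
    now rewrite E1, E2, IH1, IH2, prefix_S, app_assoc. }
  apply functional_extensionality. intros k.
  rewrite <- (nth_append_prefix _ _ (S k + cnt T)) by lia.
  rewrite <- (proj1 (H (S k))). symmetry. apply (str_prefix_limit _ k).
  pose proof (str_length (S k + T)). lia.
Qed.

(** A switch at a stage from [k] on would force the limit into [U k]. Hence the guess stays fixed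
    from [k] on, and evidence [v] against it would cause a switch at stage [npair k v]. *)
Lemma limit_layer k :
  ~ U k limit -> (forall v, ~ refutes (guess k) v).
Proof.
  intros HU.
  assert (H : forall t, k <= t -> ~ switch_at t).
  { intros t Ht Hsw. apply HU. destruct (switch _ Hsw) as (_ & Hin & _).
    apply (Hin k Ht), str_prefix_limit. }
  assert (Hg : forall d, guess (d + k) = guess k).
  { induction d as [|d IH]; [reflexivity|]. rewrite <- IH. cbn. apply copy, H. lia. }
  intros v Hv. pose proof (npair_ge_l k v) as Hle.
  apply (H (npair k v) Hle). unfold switch_at. rewrite pi2_npair.
  replace (npair k v) with (npair k v - k + k) by lia. now rewrite Hg.
Qed.

(** Each switch raises the guess by one, and the guess never passes the irrefutable [g]. *)
Lemma finitely_many_switches g :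
  (forall v, ~ refutes g v) -> exists T, forall t, T <= t -> ~ switch_at t.
Proof.
  intros Hg.
  assert (Hle : forall t, guess t <= g).
  { induction t as [|t IH]; [lia|]. destruct (classic (switch_at t)) as [H|H].
    - destruct (switch _ H) as (_ & _ & _ & ->).
      enough (guess t <> g) by lia. intros E. apply (Hg (pi2 t)). now rewrite <- E.
    - destruct (copy _ H) as (_ & _ & ->). assumption. }
  assert (Hmono : forall t d, guess t <= guess (d + t)).
  { intros t d. induction d as [|d IH]; [reflexivity|]. cbn.
    destruct (classic (switch_at (d + t))) as [H|H].
    - destruct (switch _ H) as (_ & _ & _ & ->). lia.
    - destruct (copy _ H) as (_ & _ & ->). assumption. }
  enough (H : forall n t, g - guess t <= n -> exists T, forall t, T <= t -> ~ switch_at t)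
    by now apply (H (g - guess 0) 0).
  induction n as [|n IH]; intros t Hn;
    (destruct (classic (exists t', t <= t' /\ switch_at t')) as [(t' & L & H)|H];
     [|exists t; intros t' L H'; apply H; eauto]);
    destruct (switch _ H) as (_ & _ & _ & E);
    specialize (Hmono t (t' - t)); replace (t' - t + t) with t' in Hmono by lia;
    pose proof (Hle (S t')).
  - lia.
  - apply (IH (S t')). lia.
Qed.

Lemma limit_tail g :
  (forall v, ~ refutes g v) -> exists s, limit = append s X.
Proof.
  intros Hg. destruct (finitely_many_switches g Hg) as [T HT].
  destruct (str_shape T) as [s Hs]. exists s. now apply (copying_forever T).
Qed.

End MindChanges.

(** A state [npair c (npair r g)] consists of the string with code [c] produced so far, the number [r] of bits of [x] copied since the last change of guess, and the current guess [g]. *)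
Definition next (x refute pad : nat -> nat) (t s : nat) : nat :=
  match refute (npair (pi2 (pi2 s)) (pi2 t)) with
  | 0 => npair (snoc (pi1 s) (x (pi1 (pi2 s))))
               (npair (S (pi1 (pi2 s))) (pi2 (pi2 s)))
  | S _ => npair (nat_rect (fun _ => nat) (snoc (pi1 s) 0)
                    (fun m c => zeros c (pad (npair c m))) (S t))
                 (npair 0 (S (pi2 (pi2 s))))
  end.

Definition state (x refute pad : nat -> nat) (t : nat) : nat :=
  nat_rect (fun _ => nat) (npair 0 (npair 0 0)) (next x refute pad) t.

Lemma comp_state {A} (orc x refute pad : A -> nat -> nat) :
  computable orc x -> computable orc refute -> computable orc pad ->
  computable orc (fun a => state (x a) (refute a) (pad a)).
Proof. intros. unfold state, next. computability. Qed.

(** The search runs over pairs of a number of zeros and a step bound until the enumeration of the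
    test accepts the padded string; [universal_contains_zeros] makes it succeed. *)
Lemma comp_pad {A} (orc : A -> nat -> nat) U :
  universal_ML_test U ->
  exists pad : A -> nat -> nat, computable orc pad /\
    forall a c m, cyl_sub (decode (zeros c (pad a (npair c m)))) (U m).
Proof.
  intros HU. pose proof HU as [(_ & [e He] & _) _].
  pose proof (proj1 (ce_index_set U e) He) as Hcyl. clear He.
  assert (HE : computable orc (fun _ y => fuel (fun _ => 0) e (pi2 (pi2 y))
    (npair (pi2 (pi1 y)) (zeros (pi1 (pi1 y)) (pi1 (pi2 y)))))).
  { apply (comp_fuel orc (fun _ _ => 0)); unfold zeros; computability. }
  (* [1 - fuel] vanishes exactly when the run halts within the bound. *)
  destruct (comp_mu orc (fun _ y =>
      1 - fuel (fun _ => 0) e (pi2 (pi2 y))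
            (npair (pi2 (pi1 y)) (zeros (pi1 (pi1 y)) (pi1 (pi2 y))))))
    as (F & HF & Hspec).
  - computability.
  - intros _ y. destruct (universal_contains_zeros U (decode (pi1 y)) (pi2 y) HU)
      as [n Hn].
    rewrite <- decode_zeros in Hn. apply Hcyl in Hn as [v Hv].
    rewrite code_decode in Hv. apply fuel_complete in Hv as [w Hw].
    exists (npair n w). npair_simpl. rewrite Hw. reflexivity.
  - exists (fun a y => pi1 (F a y)). split; [computability|].
    intros a c m. apply Hcyl. rewrite code_decode.
    specialize (Hspec a (npair c m)). npair_simpl.
    destruct (fuel _ e _ _) as [|v] eqn:E; [discriminate|].
    exists v. exact (fuel_sound _ _ _ _ _ E).
Qed.

(** The uniform version of the preceding section: a layer [k] of [Z] serves as a stage at which the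
    guess is correct, and the existence of an irrefutable guess keeps [Z] random. *)
Lemma absorb_mind_changes {A} (orc : A -> nat -> nat) U (X : A -> cantor)
  (refute : A -> nat -> nat) :
  universal_ML_test U ->
  computable orc (fun a => bname (X a)) -> (forall a, MLR (X a)) ->
  computable orc refute ->
  (forall a, exists g, forall v, refute a (npair g v) = 0) ->
  exists (Z : A -> cantor) (guess : A -> nat -> nat),
    computable orc (fun a => bname (Z a)) /\ computable orc guess /\
    forall a, MLR (Z a) /\
      forall k, ~ U k (Z a) -> forall v, refute a (npair (guess a k) v) = 0.
Proof.
  intros HU HX HR Href Hg.
  destruct (comp_pad orc U HU) as (pad & Hpad & Hpad').
  pose (st a := state (bname (X a)) (refute a) (pad a)).
  pose (str a t := decode (pi1 (st a t))).
  pose (guess a t := pi2 (pi2 (st a t))).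
  pose (cnt a t := pi1 (pi2 (st a t))).
  assert (Hst : computable orc st) by now apply comp_state.
  exists (fun a => limit (str a)), guess.
  split; [|split].
  - apply (comp_ext orc (fun a m => bit (pi1 (st a (S m))) m)).
    + intros a m. unfold bname, limit, str.
      rewrite <- (code_decode (pi1 (st a (S m)))) at 1. apply bit_code.
    + unfold bit. computability.
  - unfold guess. computability.
  - intros a.
    pose (refutes g v := refute a (npair g v) <> 0).
    assert (H0 : str a 0 = []).
    { apply code_str_inj. unfold str. rewrite code_decode. apply pi1_npair. }
    assert (H1 : cnt a 0 = 0) by (unfold cnt; cbn; now npair_simpl).
    assert (H2 : guess a 0 = 0) by (unfold guess; cbn; now npair_simpl).
    assert (Hcopy : forall t, ~ switch_at refutes (guess a) t ->
      str a (S t) = str a t ++ [X a (cnt a t)] /\ cnt a (S t) = S (cnt a t) /\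
      guess a (S t) = guess a t).
    { intros t H. apply NNPP in H. unfold str, cnt, guess.
      change (st a (S t)) with (next (bname (X a)) (refute a) (pad a) t (st a t)).
      unfold next. unfold guess in H. rewrite H. npair_simpl.
      repeat split. apply decode_snoc. }
    assert (Hswitch : forall t, switch_at refutes (guess a) t ->
      (exists u, str a (S t) = str a t ++ false :: u) /\
      (forall m, m <= t -> cyl_sub (str a (S t)) (U m)) /\
      cnt a (S t) = 0 /\ guess a (S t) = S (guess a t)).
    { intros t H. unfold str, cnt, guess.
      change (st a (S t)) with (next (bname (X a)) (refute a) (pad a) t (st a t)).
      unfold next. unfold switch_at, refutes, guess in H.
      destruct (refute a _) as [|r]; [easy|]. npair_simpl. clear r H.
      split; [|split; [|auto]].
      - generalize (S t) as n. induction n as [|n [u IH]]; cbn [nat_rect].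
        + exists []. apply (decode_snoc _ false).
        + rewrite decode_zeros, IH, <- app_assoc. cbn. eauto.
      (* Level [m] is secured in its own round of padding, and zeros added for later levels only
         shrink the cylinder. *)
      - intros m Hm. apply Nat.lt_succ_r in Hm. revert m Hm.
        generalize (S t) as n. induction n as [|n IH]; intros m Hm; [lia|].
        cbn [nat_rect]. destruct (Nat.eq_dec m n) as [->|]; [apply Hpad'|].
        rewrite decode_zeros. apply cyl_sub_app, IH. lia. }
    split.
    + destruct (Hg a) as [g Hga].
      destruct (limit_tail U (X a) refutes (str a) (cnt a) (guess a)
        H0 H1 H2 Hcopy Hswitch g) as [s ->].
      * intros v Hv. now apply Hv.
      * apply MLR_append, HR.
    + intros k Hk v.
      apply NNPP, (limit_layer U (X a) refutes (str a) (cnt a) (guess a)); assumption.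
Qed.

(** * Weihrauch reductions to layers *)

Definition indicator (i k : nat) : nat := if Nat.eqb k i then 1 else 0.

Lemma pairB_even p q x : pairB p q (2 * x) = p x.
Proof. unfold pairB. now rewrite Nat.even_even, Nat.div2_double. Qed.

Lemma pairB_odd p q x : pairB p q (S (2 * x)) = q x.
Proof.
  unfold pairB. rewrite Nat.even_succ, <- Nat.negb_even, Nat.even_even.
  now rewrite Nat.div2_succ_double.
Qed.

(** With the answer [i] as parameter, [subst_oracle] can run a backward reduction on any guessed
    answer. *)
Lemma pair_indicator_code :
  exists d, forall o i x, eval o d (npair i x) (pairB o (indicator i) x).
Proof.
  assert (H : computable (fun o => o) (fun o m =>
    match Nat.b2n (Nat.odd (pi2 m)) with
    | 0 => o (Nat.div2 (pi2 m))
    | S _ => 1 - ((Nat.div2 (pi2 m) - pi1 m) + (pi1 m - Nat.div2 (pi2 m)))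
    end)).
  { computability. }
  destruct H as [d Hd]. exists d. intros o i x.
  specialize (Hd o (npair i x)). rewrite pi1_npair, pi2_npair in Hd.
  replace (pairB o (indicator i) x) with
    (match Nat.b2n (Nat.odd x) with
     | 0 => o (Nat.div2 x)
     | S _ => 1 - ((Nat.div2 x - i) + (i - Nat.div2 x))
     end); [exact Hd|].
  unfold pairB, indicator. rewrite <- Nat.negb_odd.
  destruct (Nat.odd x); cbn [negb Nat.b2n]; [|reflexivity].
  destruct (Nat.eqb_spec (Nat.div2 x) i); lia.
Qed.

(** Lets a program written for [p] run inside a backward reduction, whose oracle is a pair; [u] is a
    dummy. *)
Lemma left_oracle_code :
  exists d, forall p q u x, eval (pairB p q) d (npair u x) (p x).
Proof.
  assert (H : computable (fun o => o) (fun o m => o (2 * pi2 m))).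
  { apply (comp_oracle (fun o => o)). computability. }
  destruct H as [d Hd]. exists d. intros p q u x.
  specialize (Hd (pairB p q) (npair u x)). now rewrite pi2_npair, pairB_even in Hd.
Qed.

(** The named number is the first zero of [1 - indicator i]. *)
Lemma right_indicator_code :
  exists d, forall p i x, eval (pairB p (indicator i)) d x i.
Proof.
  assert (H : computable (fun o => o) (fun o m => 1 - o (S (2 * pi2 m)))).
  { computability. }
  destruct H as [d Hd]. exists (cMu d). intros p i x.
  assert (E : forall m, eval (pairB p (indicator i)) d (npair x m) (1 - indicator i m)).
  { intros m. specialize (Hd (pairB p (indicator i)) (npair x m)).
    now rewrite pi2_npair, pairB_odd in Hd. }
  unfold indicator in E. constructor.
  - specialize (E i). now rewrite Nat.eqb_refl in E.
  - intros m Hm. exists 0. specialize (E m).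
    now rewrite (proj2 (Nat.eqb_neq m i)) in E by lia.
Qed.

Lemma TF_unique e p q q' : TF e p q -> TF e p q' -> q = q'.
Proof.
  intros H H'. apply functional_extensionality. intros n.
  exact (eval_det _ _ _ _ _ (H n) (H' n)).
Qed.

Lemma bname_inj X Y : bname X = bname Y -> X = Y.
Proof.
  intros E. apply functional_extensionality. intros n.
  apply (f_equal (fun f => f n)) in E. unfold bname in E.
  now destruct (X n), (Y n).
Qed.

Lemma delta_MLR_bname q X : delta_MLR q X <-> q = bname (proj1_sig X).
Proof.
  split; [intros H; now apply functional_extensionality | now intros -> n].
Qed.

Lemma delta_nat_indicator r i : delta_nat r i <-> r = indicator i.
Proof.
  split; [intros H; now apply functional_extensionality | now intros -> n].
Qed.

(** * Realizers and choices of layers *)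

Lemma MLR_layer U X : ML_test U -> MLR X -> exists i, ~ U i X.
Proof.
  intros HU HX. apply NNPP. intros H. apply (HX U HU). intros i.
  apply NNPP. eauto.
Qed.

(** The realizer answers [None] off the names of random sequences, so any answer certifies that the
    query named one. *)
Lemma layer_realizer U (layer : cantor -> nat) :
  (forall X, MLR X -> ~ U (layer X) X) ->
  exists Gamma : (nat -> nat) -> option (nat -> nat),
    realizes delta_MLR delta_nat (LAY U) (fun p q => Gamma p = Some q) /\
    forall q r, Gamma q = Some r ->
      exists X, MLR X /\ q = bname X /\ r = indicator (layer X).
Proof.
  intros HL.
  exists (fun q =>
    match excluded_middle_informative (exists X, MLR X /\ q = bname X) with
    | left H =>
        Some (indicator (layer (proj1_sig (constructive_indefinite_description _ H))))
    | right _ => None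
    end).
  split.
  - intros q [X HX] Hq _. apply delta_MLR_bname in Hq. cbn in Hq.
    destruct excluded_middle_informative as [H|H]; [|exfalso; eauto].
    destruct constructive_indefinite_description as (X' & HX' & E). cbn.
    rewrite Hq in E. apply bname_inj in E as <-.
    eexists. split; [reflexivity|]. exists (layer X).
    split; [now apply delta_nat_indicator | now apply HL].
  - intros q r E.
    destruct excluded_middle_informative as [H|H]; [|discriminate].
    destruct constructive_indefinite_description as (X & HX & ->).
    injection E as <-. now exists X.
Qed.

(** Every layer of the random sequence [X] is the answer of some realizer, so [Psi] succeeds on all of them. *)
Lemma LAY_reduction U {X Y : Type} (dX : (nat -> nat) -> X -> Prop)
  (dY : (nat -> nat) -> Y -> Prop) (f : X -> Y -> Prop) Phi Psi :
  ML_test U ->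
  (forall Gamma : (nat -> nat) -> option (nat -> nat),
     realizes delta_MLR delta_nat (LAY U) (fun p q => Gamma p = Some q) ->
     realizes dX dY f
       (fun p s => exists q r, TF Phi p q /\ Gamma q = Some r /\ TF Psi (pairB p r) s)) ->
  forall p x, dX p x -> dom f x ->
  exists Z, MLR Z /\ TF Phi p (bname Z) /\
    forall i, ~ U i Z ->
      exists s y, TF Psi (pairB p (indicator i)) s /\ dY s y /\ f x y.
Proof.
  intros HU Hred p x Hp Hx.
  assert (Hrun : forall layer : cantor -> nat, (forall Z, MLR Z -> ~ U (layer Z) Z) ->
    exists Z, MLR Z /\ TF Phi p (bname Z) /\
      exists s y, TF Psi (pairB p (indicator (layer Z))) s /\ dY s y /\ f x y).
  { intros layer HL. destruct (layer_realizer U layer HL) as (Gamma & HG & Hdom).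
    destruct (Hred Gamma HG p x Hp Hx) as (s & (q & r & Hq & Hr & Hs) & y & Hy & Hf).
    destruct (Hdom q r Hr) as (Z & HZ & -> & ->). exists Z. eauto 8. }
  pose (layer Z := epsilon (inhabits 0) (fun i => ~ U i Z)).
  assert (HL : forall Z, MLR Z -> ~ U (layer Z) Z).
  { intros Z HZ. now apply (epsilon_spec (inhabits 0) (fun i => ~ U i Z)), MLR_layer. }
  destruct (Hrun layer HL) as (Z & HZ & HPhi & _).
  exists Z. split; [assumption|]. split; [assumption|]. intros i Hi.
  (* Changing the chosen layer at [Z] alone forces the answer [i], since [Phi] has a unique output
     on [p]. *)
  destruct (Hrun (fun Z' => if excluded_middle_informative (Z' = Z) then i else layer Z'))
    as (Z' & _ & HPhi' & H).
  - intros Z' HZ'. destruct excluded_middle_informative as [->|]; auto.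
  - rewrite (bname_inj _ _ (TF_unique _ _ _ _ HPhi' HPhi)) in H.
    now destruct excluded_middle_informative.
Qed.

Theorem theorem5p9
  (U : nat -> cantor -> Prop) (HU : universal_ML_test U)
  (Q R S : Type)
  (dQ : (nat -> nat) -> Q -> Prop) (dR : (nat -> nat) -> R -> Prop)
  (dS : (nat -> nat) -> S -> Prop)
  (HQ : is_representation dQ) (HR : is_representation dR)
  (HS : is_representation dS)
  (f0 : R -> S -> Prop) (g0 : Q -> R -> Prop)
  (Hf : Wred dR dS f0 delta_MLR delta_nat (LAY U))
  (Hg : Wred dQ dR g0 delta_MLR delta_nat (LAY U))
  (Hcomp : forall x, dom g0 x -> forall y, g0 x y -> dom f0 y) :
  Wred dQ dS (mcomp f0 g0) delta_MLR delta_nat (LAY U).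
Proof.
  pose proof (proj1 HU) as HT.
  destruct Hf as (Phi_f & Psi_f & Hf), Hg as (Phi_g & Psi_g & Hg).
  pose proof (LAY_reduction U dR dS f0 Phi_f Psi_f HT Hf) as Rf.
  pose proof (LAY_reduction U dQ dR g0 Phi_g Psi_g HT Hg) as Rg.
  clear Hf Hg HQ HR HS.
  destruct pair_indicator_code as [pc Hpc], (membership_code U HT) as [mem Hmem].
  (* For a correct [i], [inner] computes from [p] the name of an instance of [f0], and [second]
     below feeds it to [Phi_f] to obtain [Y]. *)
  pose (inner := subst_oracle pc Psi_g).
  assert (Hinner : forall p i s, TF Psi_g (pairB p (indicator i)) s ->
    forall x, eval p inner (npair i x) (s x)).
  { intros p i s Hs x.
    now apply (eval_subst_oracle p pc i (pairB p (indicator i))). }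
  pose (second := subst_oracle inner Phi_f).
  assert (Hsecond : forall p i s Y, TF Psi_g (pairB p (indicator i)) s ->
    TF Phi_f s (bname Y) -> forall x, eval p second (npair i x) (bname Y x)).
  { intros p i s Y Hs HY x. now apply (eval_subst_oracle p inner i s); [apply Hinner|]. }
  (* These look for evidence of [X] in [U i] and of [Y] in [U j]. [cSnd] discards the parameter of
     the first, which runs with the dummy [0]. *)
  pose (test1 := subst_oracle (cComp Phi_g cSnd) mem).
  pose (test2 := subst_oracle second mem).
  (* Restricting the parameters to such pairs makes [X] uniformly computable from the oracle and
     guarantees a correct guess. *)
  pose (good := fun pX : (nat -> nat) * cantor =>
    MLR (snd pX) /\ TF Phi_g (fst pX) (bname (snd pX)) /\
    forall i, ~ U i (snd pX) -> exists s Y,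
      TF Psi_g (pairB (fst pX) (indicator i)) s /\ MLR Y /\ TF Phi_f s (bname Y)).
  pose (orc := fun a : {pX | good pX} => fst (proj1_sig a)).
  pose (X := fun a : {pX | good pX} => snd (proj1_sig a)).
  (* [y] codes the guess [(i, j)], a prefix length and a step bound. Bounded evaluation keeps
     [refute] total even where a wrong [i] makes [test2] diverge. *)
  pose (refute := fun a y =>
    fuel (orc a) test1 (pi2 (pi2 y)) (npair 0 (npair (pi1 (pi1 y)) (pi1 (pi2 y)))) +
    fuel (orc a) test2 (pi2 (pi2 y))
      (npair (pi1 (pi1 y)) (npair (pi2 (pi1 y)) (pi1 (pi2 y))))).
  assert (Hunrefuted : forall a g,
    (forall v, refute a (npair g v) = 0) <->
    ~ U (pi1 g) (X a) /\
    forall s Y, TF Psi_g (pairB (orc a) (indicator (pi1 g))) s ->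
      TF Phi_f s (bname Y) -> ~ U (pi2 g) Y).
  { intros [[p Z] (HZ & HPhi & HYs)] g. cbn in HZ, HPhi, HYs.
    unfold refute, X, orc. cbn [proj1_sig fst snd].
    assert (H1 : forall x y, eval p test1 (npair 0 x) y <-> eval (bname Z) mem x y).
    { apply eval_subst_oracle. intros x. econstructor; [constructor|apply HPhi]. }
    assert (H2 : forall s Y, TF Psi_g (pairB p (indicator (pi1 g))) s ->
      TF Phi_f s (bname Y) ->
      forall x y, eval p test2 (npair (pi1 g) x) y <-> eval (bname Y) mem x y).
    { intros s Y Hs HY. apply eval_subst_oracle. now apply (Hsecond p _ s). }
    split.
    - intros H. split.
      + intros HUZ. apply Hmem in HUZ as (n & y & Hy).
        apply H1, fuel_complete in Hy as [w Hw].
        specialize (H (npair n w)). npair_simpl. rewrite Hw in H. discriminate.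
      + intros s Y Hs HY HUY. apply Hmem in HUY as (n & y & Hy).
        apply (H2 s Y Hs HY), fuel_complete in Hy as [w Hw].
        specialize (H (npair n w)). npair_simpl. rewrite Hw in H. lia.
    - intros [HUZ HUY] v. rewrite pi1_npair, pi2_npair.
      destruct (fuel p test1 _ _) as [|y] eqn:E1.
      + destruct (fuel p test2 _ _) as [|y] eqn:E2; [reflexivity|exfalso].
        (* As the first half of the guess is correct, [test2] works on a genuine [Y], and its
           halting proves membership. *)
        destruct (HYs _ HUZ) as (s & Y & Hs & _ & HY).
        apply fuel_sound, (H2 s Y Hs HY) in E2.
        apply (HUY s Y Hs HY), Hmem. eauto.
      + exfalso. apply fuel_sound, H1 in E1. apply HUZ, Hmem. eauto. }
  destruct (absorb_mind_changes orc U X refute HU) as (Z & guess & [Phi HPhi] & [gc Hgc] & HZ).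
  { exists Phi_g. intros [[p Z] (HZ & HPhi & HYs)] x. apply HPhi. }
  { intros [[p Z] (HZ & HPhi & HYs)]. exact HZ. }
  { assert (Horc : computable orc orc) by (exists cOracle; constructor).
    unfold refute. apply comp_add; apply comp_fuel; computability. }
  { intros [[p Z] Ha]. pose proof Ha as (HZ & HPhi & HYs). cbn in HZ, HPhi, HYs.
    (* Layers of [Z] and of the resulting [Y] form a correct guess; it is irrefutable because
       [Psi_g] and [Phi_f] have unique outputs. *)
    destruct (MLR_layer U Z HT HZ) as [i Hi].
    destruct (HYs i Hi) as (s & Y & Hs & HY & HsY).
    destruct (MLR_layer U Y HT HY) as [j Hj].
    exists (npair i j). apply Hunrefuted. rewrite pi1_npair, pi2_npair.
    split; [exact Hi|]. intros s' Y' Hs' HsY'. unfold orc in Hs'. cbn in Hs'.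
    rewrite (TF_unique _ _ _ _ Hs' Hs) in HsY'.
    now rewrite (bname_inj _ _ (TF_unique _ _ _ _ HsY' HsY)). }
  destruct left_oracle_code as [lc Hlc], right_indicator_code as [kc Hkc].
  (* [G] recovers [k] from the answer of the realizer and computes the guess at stage [k] from
     [p]. *)
  pose (G := cComp (subst_oracle lc gc) (cPair cZero kc)).
  (* [outer] runs [Psi_f] on the name simulated by [inner] together with the answer [j]. The final
     program nests one parameter per simulation: the dummy [0] for [lc], then [i], then [j]. *)
  pose (outer := subst_oracle inner (subst_oracle pc Psi_f)).
  exists Phi, (cComp (subst_oracle lc outer)
    (cPair cZero (cPair (cComp cFst G) (cPair (cComp cSnd G) cId)))).
  intros Gamma HGamma p x Hpx (z & y0 & Hxy0 & _).
  assert (Hx : dom g0 x) by now exists y0.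
  destruct (Rg p x Hpx Hx) as (X0 & HX0 & HPhi0 & HX0i).
  assert (Ha : good (p, X0)).
  { split; [exact HX0|]. split; [exact HPhi0|]. intros i Hi.
    destruct (HX0i i Hi) as (s & y & Hs & Hsy & Hxy).
    destruct (Rf s y Hsy (Hcomp x Hx y Hxy)) as (Y & HY & HsY & _).
    now exists s, Y. }
  pose (a := exist good (p, X0) Ha). destruct (HZ a) as [HMLR Hlayer].
  destruct (HGamma (bname (Z a)) (exist MLR (Z a) HMLR)) as (r & Hr & k & Hrk & Hk).
  { now apply delta_MLR_bname. }
  { exact (MLR_layer U (Z a) HT HMLR). }
  apply delta_nat_indicator in Hrk as ->.
  pose proof (proj1 (Hunrefuted a (guess a k)) (Hlayer k Hk)) as [Hi Hj].
  set (i := pi1 (guess a k)) in *. set (j := pi2 (guess a k)) in *.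
  destruct (HX0i i Hi) as (s & y & Hs & Hsy & Hxy).
  (* Composability makes [y] an instance of [f0], and the second half of the guess is then a layer
     of [Y]. *)
  destruct (Rf s y Hsy (Hcomp x Hx y Hxy)) as (Y & HY & HsY & HYj).
  destruct (HYj j (Hj s Y Hs HsY)) as (s' & z' & Hs' & Hsz' & Hyz').
  exists s'. split; [|exists z'; split; [exact Hsz'|now exists y]].
  exists (bname (Z a)), (indicator k). split; [exact (HPhi a)|]. split; [exact Hr|].
  assert (HG : forall n, eval (pairB p (indicator k)) G n (guess a k)).
  { intros n. apply e_comp with (npair 0 k); [constructor; [constructor|apply Hkc]|].
    apply (eval_subst_oracle _ lc 0 p); [intros; apply Hlc|]. exact (Hgc a k). }
  intros n. apply e_comp with (npair 0 (npair i (npair j n))).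
  - constructor; [constructor|]. constructor; [|constructor; [|constructor]].
    + econstructor; [apply HG|apply eval_fst].
    + econstructor; [apply HG|apply eval_snd].
  - apply (eval_subst_oracle _ lc 0 p); [intros; apply Hlc|].
    apply (eval_subst_oracle _ inner i s); [now apply Hinner|].
    apply (eval_subst_oracle _ pc j (pairB s (indicator j))); [intros; apply Hpc|].
    apply Hs'.
Qed.
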